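(* Let $U$ be a unital of order $q$ in $\mathcal{NP}$ containing $(0,1,0)$ and $(0,0,1)$, such that the tangent line of $U$ at $(0,0,1)$ passes through $(1,0,0)$. Let $G=\mathrm{Aut}(U)\cap\mathfrak L$, $W=\{w\in\mathbb{F}_{q^2}:\phi(1,1,0,w)\in G\}$, $G_1=G\cap\hat{\mathfrak R}_0$, $C=\{c:\phi(c,d,0,0)\in G_1\text{ for some }d\}$, let $\delta:C\to\mathbb{F}_{q^2}^*$ be given by $\delta(c)=d$ whenever $\phi(c,d,0,0)\in G_1$ (well defined), and set $\delta(0)=0$. Assume $o(G)=q(q^2-1)$. Then $$U=\{(x,\,b\,\delta(x)+w,\,1):x\in\mathbb{F}_{q^2},\ w\in W\}\cup\{(0,1,0)\}$$ for some $b\in\mathbb{F}_{q^2}^*\setminus W$ (with $b\,\delta(x)$ the field product).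
   Context: Let $p$ be an odd prime, $q=p^e$. The regular nearfield $\mathcal N(2,q)$ has underlying set $\mathbb{F}_{q^2}$, field addition, and multiplication $x\star y=xy$ if $y$ is a nonzero square of $\mathbb{F}_{q^2}$, $x\star y=x^qy$ if $y$ is a nonsquare, $x\star0=0$. The plane $\mathcal{NP}$ has points $(x,y,1)$ ($x,y\in\mathbb{F}_{q^2}$), $(1,y,0)$, $(0,1,0)$; lines $[s,1,t]$, $[1,0,t]$, $[0,0,1]$; $(x,y,z)$ lies on $[s,u,t]$ iff $x\star s+y\star u+z\star t=0$. $\phi(c,d,u,v)$ ($c,d\ne0$) is the collineation acting on affine points by $(x,y,1)\mapsto(x\star c+u,y\star d+v,1)$, $\gamma(c,d,u,v)$ the one acting by $(x,y,1)\mapsto(y\star c+u,x\star d+v,1)$; $\hat{\mathfrak R}_0=\{\phi(c,d,0,0)\}$, $\mathfrak L=\{\phi(c,d,u,v)\}\cup\{\gamma(c,d,u,v)\}$. A unital of order $q$ is a set of $q^3+1$ points meeting every line in $1$ (tangent) or $q+1$ (secant) points; $\mathrm{Aut}(U)$ is the group of collineations preserving $U$. *)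

(* Defs.v *)
From HB Require Import structures.
From mathcomp Require Import all_boot all_order all_fingroup all_algebra all_field.
Set Implicit Arguments.
Unset Strict Implicit.
Unset Printing Implicit Defensive.
Import GRing.Theory.
Local Open Scope ring_scope.

(* [F] stands for the field with q^2 elements. *)

Definition nonzero_square (F : finFieldType) (y : F) : bool :=
  (y != 0) && [exists z : F, y == z ^+ 2].

(* The product of the regular nearfield N(2,q); its addition is that of [F]. *)
Definition nmul (F : finFieldType) (q : nat) (x y : F) : F :=
  if y == 0 then 0 else if nonzero_square y then x * y else x ^+ q * y.

(* Aff x y = (x,y,1), Inf y = (1,y,0), InfV = (0,1,0). *)
Inductive point (F : finFieldType) := Aff of F & F | Inf of F | InfV.
Arguments InfV {F}.

(* LAff s t = [s,1,t], LVert t = [1,0,t], LInf = [0,0,1]. *)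
Inductive line (F : finFieldType) := LAff of F & F | LVert of F | LInf.
Arguments LInf {F}.

Definition point_coords (F : finFieldType) (P : point F) : F * F * F :=
  match P with
  | Aff x y => (x, y, 1)
  | Inf y => (1, y, 0)
  | InfV => (0, 1, 0)
  end.

Definition line_coords (F : finFieldType) (l : line F) : F * F * F :=
  match l with
  | LAff s t => (s, 1, t)
  | LVert t => (1, 0, t)
  | LInf => (0, 0, 1)
  end.

Definition point_code (F : finFieldType) (P : point F) : F * F + option F :=
  match P with
  | Aff x y => inl (x, y)
  | Inf y => inr (Some y)
  | InfV => inr None
  end.

Definition point_decode (F : finFieldType) (a : F * F + option F) : point F :=
  match a with
  | inl (x, y) => Aff x y
  | inr (Some y) => Inf y
  | inr None => InfV
  end.

Lemma point_codeK (F : finFieldType) :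
  cancel (@point_code F) (@point_decode F).
Proof. by case. Qed.

HB.instance Definition _ (F : finFieldType) :=
  Finite.copy (point F) (can_type (@point_codeK F)).

Definition line_code (F : finFieldType) (l : line F) : F * F + option F :=
  match l with
  | LAff s t => inl (s, t)
  | LVert t => inr (Some t)
  | LInf => inr None
  end.

Definition line_decode (F : finFieldType) (a : F * F + option F) : line F :=
  match a with
  | inl (s, t) => LAff s t
  | inr (Some t) => LVert t
  | inr None => LInf
  end.

Lemma line_codeK (F : finFieldType) : cancel (@line_code F) (@line_decode F).
Proof. by case. Qed.

HB.instance Definition _ (F : finFieldType) :=
  Finite.copy (line F) (can_type (@line_codeK F)).

Definition incident (F : finFieldType) (q : nat) (P : point F) (l : line F) :
    bool :=
  let: (x, y, z) := point_coords P in
  let: (s, u, t) := line_coords l in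
  nmul q x s + nmul q y u + nmul q z t == 0.

Definition points_on (F : finFieldType) (q : nat) (l : line F) :
    {set point F} :=
  [set P | incident q P l].

Definition collineation (F : finFieldType) (q : nat) (f : {perm point F}) :
    bool :=
  [forall l : line F, exists m : line F,
     f @: points_on q l == points_on q m].

(* For nonzero c and d there is exactly one [f] with [is_phi q c d u v f], the
   collineation phi(c,d,u,v), and none if c or d is zero; similarly for
   [is_gamma]. *)
Definition is_phi (F : finFieldType) (q : nat) (c d u v : F)
    (f : {perm point F}) : bool :=
  collineation q f &&
  [forall x : F, forall y : F,
     f (Aff x y) == Aff (nmul q x c + u) (nmul q y d + v)].

Definition is_gamma (F : finFieldType) (q : nat) (c d u v : F)
    (f : {perm point F}) : bool :=
  collineation q f &&
  [forall x : F, forall y : F,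
     f (Aff x y) == Aff (nmul q y c + u) (nmul q x d + v)].

Definition phi_in (F : finFieldType) (q : nat) (A : {set {perm point F}})
    (c d u v : F) : bool :=
  [exists f in A, is_phi q c d u v f].

Definition grpR0 (F : finFieldType) (q : nat) : {set {perm point F}} :=
  [set f | [exists c : F, exists d : F,
     [&& c != 0, d != 0 & is_phi q c d 0 0 f]]].

Definition grpL (F : finFieldType) (q : nat) : {set {perm point F}} :=
  [set f | [exists c : F, exists d : F, exists u : F, exists v : F,
     [&& c != 0, d != 0 & is_phi q c d u v f || is_gamma q c d u v f]]].

Definition unital (F : finFieldType) (q : nat) (U : {set point F}) : Prop :=
  #|U| = (q ^ 3 + 1)%N /\
  forall l : line F,
    #|U :&: points_on q l| = 1%N \/ #|U :&: points_on q l| = (q + 1)%N.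

Definition tangent_at (F : finFieldType) (q : nat) (U : {set point F})
    (P : point F) (l : line F) : Prop :=
  P \in U /\ incident q P l /\ #|U :&: points_on q l| = 1%N.

Definition autU (F : finFieldType) (q : nat) (U : {set point F}) :
    {set {perm point F}} :=
  [set f | collineation q f & f @: U == U].

Definition grpG (F : finFieldType) (q : nat) (U : {set point F}) :
    {set {perm point F}} :=
  autU q U :&: grpL F q.

Definition setW (F : finFieldType) (q : nat) (U : {set point F}) : {set F} :=
  [set w | phi_in q (grpG q U) 1 1 0 w].

Definition grpG1 (F : finFieldType) (q : nat) (U : {set point F}) :
    {set {perm point F}} :=
  grpG q U :&: grpR0 F q.

Definition domC (F : finFieldType) (q : nat) (U : {set point F}) : {set F} :=
  [set c | [exists d : F, phi_in q (grpG1 q U) c d 0 0]].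

(* Values of [delta] outside C and 0 are unconstrained. *)
Definition is_delta (F : finFieldType) (q : nat) (U : {set point F})
    (delta : F -> F) : Prop :=
  delta 0 = 0 /\
  forall c d : F,
    c \in domC q U -> phi_in q (grpG1 q U) c d 0 0 -> delta c = d.

(* Main.v *)
(** Since [(1,0,0)] is not in [U], no gamma preserves [U], so [G] consists of maps
    phi(c,d,u,v); a map phi(1,d,0,w) in [G] has [d = 1] because its order divides
    both [q^2 - 1] and [q]. The orbit of [(0,0,1)] under [G] lies among the feet
    of the [q + 1] or fewer affine tangents through [(1,0,0)], while its stabilizer
    acts freely on the [q^2 - 1] points [(x,0,1)], [x != 0]; [o(G) = q(q^2 - 1)]
    then forces the orbit to have size [q] and [C] to be all of [F^*]. Freeness
    again puts the orbit on the line [x = 0], where it is [{(0,w,1) : w in W}].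
    By transitivity every line [x = a] carries [q] affine points of [U], and the
    point [(1,b,1)] is moved to [(x, b * delta(x), 1)] with the nearfield product.
    This is the field product since [delta(x)] is always a square: it acts freely
    on the [q - 1] nonzero elements of [W], whereas a nonsquare does not have
    nearfield order dividing [q - 1]. *)

Require Import Defs.
From HB Require Import structures.
From mathcomp Require Import all_boot all_order all_fingroup all_algebra all_solvable all_field.
From mathcomp Require Import zify ring.
Set Implicit Arguments.
Unset Strict Implicit.
Unset Printing Implicit Defensive.
Import GRing.Theory.
Local Open Scope ring_scope.

(** Freeness makes every point stabilizer trivial, so [S] splits into orbits of size [#|H|]. *)
Lemma card_free_dvdn (T : finType) (H : {group {perm T}}) (S : {set T}) :
  (forall f x, f \in H -> x \in S -> f x \in S) ->
  (forall f x, f \in H -> x \in S -> f x = x -> f = 1%g) ->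
  (#|H| %| #|S|)%N.
Proof.
move=> stab free.
have actsHS : [acts H, on S | 'P].
  apply/subsetP=> f Hf; rewrite !inE /=; apply/subsetP=> x Sx.
  by rewrite inE; apply: stab.
rewrite -(acts_sum_card_orbit actsHS); apply: dvdn_sum => _ /imsetP[x Sx ->].
suff C1 : 'C_H[x | 'P]%g = 1%g by rewrite -(card_orbit_stab 'P H x) C1 cards1 muln1.
apply/trivgP/subsetP=> f /setIP[Hf]; rewrite !inE sub1set inE /= => /eqP fx.
by rewrite (free f x).
Qed.

(** * Squares and the Frobenius map in the field with [q ^ 2] elements *)

Section Nearfield.

Variables (p e q : nat) (F : finFieldType).
Hypotheses (hp : prime p) (podd : odd p) (he : (0 < e)%N).
Hypotheses (hq : q = (p ^ e)%N) (hF : #|F| = (q ^ 2)%N).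

Local Notation "x ** y" := (nmul q x y) (at level 40, left associativity).
Let N := ((q ^ 2).-1./2)%N.

Lemma odd_q : odd q.
Proof. by rewrite hq oddX podd orbT. Qed.

Lemma q_gt2 : (2 < q)%N.
Proof.
have := odd_q; have : (1 < q)%N by rewrite hq -(exp1n e) ltn_exp2r ?prime_gt1.
by case: q => [|[|[|]]].
Qed.

Lemma double_N : (N.*2 = (q ^ 2).-1)%N.
Proof.
have : odd (q ^ 2) by rewrite oddX odd_q.
by rewrite /N; lia.
Qed.

Lemma expf_double_N (x : F) : x != 0 -> x ^+ N.*2 = 1.
Proof.
move=> x0; have q2 : (0 < q ^ 2)%N by rewrite expn_gt0 (ltn_trans _ q_gt2).
by apply: (mulfI x0); rewrite -exprS double_N prednK // -hF expf_card mulr1.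
Qed.

Lemma euler_criterion (y : F) : y != 0 -> nonzero_square y = (y ^+ N == 1).
Proof.
move=> y0; rewrite /nonzero_square y0 /=; apply/existsP/eqP => [[z /eqP yE]|yN].
  have z0 : z != 0 by apply: contra_neq y0 => z0; rewrite yE z0 expr0n.
  by rewrite yE -exprM mul2n expf_double_N.
have N0 : (0 < N.*2)%N by rewrite double_N; have := q_gt2; nia.
have /hasP[g _ gP] : has (N.*2).-primitive_root (enum [pred x : F | x != 0]).
  apply: has_prim_root; rewrite ?enum_uniq //.
    by apply/allP=> x; rewrite mem_enum unity_rootE inE => /expf_double_N ->.
  rewrite -cardE double_N -hF (cardC1 (0 : F)) //.
have [i yE] := prim_rootP gP (expf_double_N y0).
(* As [y] is [g ^+ i], [y ^+ N = 1] makes the order [2 * N] of [g] divide [i * N], so [i] is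
   even. *)
have : (2 * N %| i * N)%N by rewrite mul2n (prim_order_dvd gP) exprM -yE yN.
rewrite dvdn_pmul2r; last by rewrite -double_gt0.
case/dvdnP=> j ij.
by exists (g ^+ j); rewrite yE ij exprM.
Qed.

Lemma expf_N (y : F) : y != 0 -> (y ^+ N == 1) || (y ^+ N == -1).
Proof.
by move=> y0; rewrite -eqf_sqr expr1n -exprM muln2 expf_double_N.
Qed.

(** By Euler's criterion squareness is the sign [x ^+ N], and signs multiply. *)
Lemma nonzero_squareM (x y : F) : x != 0 -> y != 0 ->
  nonzero_square (x * y) = (nonzero_square x == nonzero_square y).
Proof.
move=> x0 y0; rewrite !euler_criterion ?mulf_neq0 // exprMn.
have [->|nx] := eqVneq (x ^+ N) 1; first by rewrite mul1r; case: eqP.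
have := expf_N x0; rewrite (negbTE nx) /= => /eqP xN.
have := expf_N y0; have [-> _|ny /= /eqP ->] := eqVneq (y ^+ N) 1.
  by rewrite mulr1 (negbTE nx).
by rewrite xN mulrNN mul1r !eqxx.
Qed.

Lemma nonzero_squareX (x : F) : x != 0 -> nonzero_square (x ^+ q) = nonzero_square x.
Proof.
move=> x0; rewrite !euler_criterion ?expf_neq0 // exprAC.
have /orP[/eqP-> | /eqP->] := expf_N x0; first by rewrite expr1n eqxx.
by rewrite -signr_odd odd_q expr1.
Qed.

Lemma frobK (x : F) : (x ^+ q) ^+ q = x.
Proof. by rewrite -exprM mulnn -hF expf_card. Qed.

Lemma frobD (x y : F) : (x + y) ^+ q = x ^+ q + y ^+ q.
Proof.
rewrite exprDn_pchar // hq pnatX orbC.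
have pF : p \in [pchar F] by apply: (@card_finPcharP _ _ (e * 2)) => //; rewrite hF hq expnM.
by apply/orP; right; rewrite (eq_pnat _ (pcharf_eq pF)) pnat_id.
Qed.

Lemma frobN (x : F) : (- x) ^+ q = - x ^+ q.
Proof. by rewrite exprNn -signr_odd odd_q mulN1r. Qed.

Lemma frob0 : (0 : F) ^+ q = 0.
Proof. by rewrite expr0n; case: q q_gt2. Qed.

(** * Nearfield laws and the free action of right multiplications *)

Lemma nmulr0 (x : F) : x ** 0 = 0.
Proof. by rewrite /nmul eqxx. Qed.

Lemma nmul0r (x : F) : 0 ** x = 0.
Proof. by rewrite /nmul frob0 mul0r !if_same. Qed.

Lemma nonzero_square1 : nonzero_square (1 : F).
Proof. by rewrite euler_criterion ?oner_neq0 // expr1n. Qed.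

Lemma nmulr1 (x : F) : x ** 1 = x.
Proof. by rewrite /nmul oner_eq0 nonzero_square1 mulr1. Qed.

Lemma nmul1r (x : F) : 1 ** x = x.
Proof. by rewrite /nmul expr1n mul1r if_same; case: eqP. Qed.

Lemma nmulDl (x y z : F) : (x + y) ** z = x ** z + y ** z.
Proof. by rewrite /nmul frobD; case: eqP => _; [rewrite addr0 | case: ifP; rewrite mulrDl]. Qed.

Lemma nmulNl (x z : F) : (- x) ** z = - (x ** z).
Proof. by rewrite /nmul frobN; case: eqP => _; [rewrite oppr0 | case: ifP; rewrite mulNr]. Qed.

Lemma nmulBl (x y z : F) : (x - y) ** z = x ** z - y ** z.
Proof. by rewrite nmulDl nmulNl. Qed.

Lemma nmul_eq0 (x y : F) : (x ** y == 0) = (x == 0) || (y == 0).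
Proof.
rewrite /nmul; case: (eqVneq y 0) => [_|y0]; first by rewrite eqxx orbT.
by case: ifP; rewrite mulf_eq0 (negbTE y0) ?orbF // expf_eq0 (ltn_trans _ q_gt2).
Qed.

Lemma nmul_square (x y : F) : nonzero_square y -> x ** y = x * y.
Proof. by move=> sy; rewrite /nmul sy; case: eqP sy => // -> ; rewrite mulr0. Qed.

Lemma nmul_nonsquare (x y : F) : ~~ nonzero_square y -> x ** y = x ^+ q * y.
Proof. by move/negbTE=> sy; rewrite /nmul sy; case: eqP => // ->; rewrite mulr0. Qed.

(** The Frobenius twist keeps squareness, so the quadratic character is multiplicative for [**] too;
    this is what makes [**] associative. *)
Lemma nonzero_square_nmul (x y : F) : x != 0 -> y != 0 ->
  nonzero_square (x ** y) = (nonzero_square x == nonzero_square y).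
Proof.
move=> x0 y0; have [sy|sy] := boolP (nonzero_square y).
  by rewrite nmul_square // nonzero_squareM // sy.
by rewrite nmul_nonsquare // nonzero_squareM ?expf_neq0 // nonzero_squareX // (negbTE sy).
Qed.

Lemma nmulA (x y z : F) : x ** y ** z = x ** (y ** z).
Proof.
have [->|y0] := eqVneq y 0; first by rewrite nmulr0 !nmul0r nmulr0.
have [->|z0] := eqVneq z 0; first by rewrite !nmulr0.
have syz := nonzero_square_nmul y0 z0.
have [sy|sy] := boolP (nonzero_square y); have [sz|sz] := boolP (nonzero_square z).
- by rewrite (@nmul_square x (y ** z)) ?syz ?sy ?sz // !nmul_square // mulrA.
- rewrite (@nmul_nonsquare x (y ** z)) ?syz ?sy ?(negbTE sz) //.
  by rewrite !(@nmul_nonsquare _ z) // nmul_square // exprMn mulrA.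
- rewrite (@nmul_nonsquare x (y ** z)) ?syz ?sz ?(negbTE sy) //.
  by rewrite !(@nmul_square _ z) // nmul_nonsquare // mulrA.
(* Two twists compose to [x ^+ (q ^ 2) = x], in agreement with the untwisted product by the square
   [y ** z]. *)
- rewrite (@nmul_square x (y ** z)) ?syz ?(negbTE sz) ?(negbTE sy) //.
  by rewrite !(@nmul_nonsquare _ z) // nmul_nonsquare // exprMn frobK mulrA.
Qed.

Lemma nmul_injl (z : F) : z != 0 -> injective (nmul q ^~ z).
Proof.
move=> z0 x y /eqP; rewrite -subr_eq0 -nmulBl nmul_eq0 (negbTE z0) orbF subr_eq0.
by move/eqP.
Qed.

Lemma nmul_surj (z y : F) : z != 0 -> exists x, x ** z = y.
Proof.
move=> /nmul_injl inj; have [g _ gK] := injF_bij inj.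
by exists (g y); apply: gK.
Qed.

(** A nonsquare [d] would change the quadratic character of [x], so the product is the field
    product. *)
Lemma nmul_fix (x d : F) : x != 0 -> x ** d = x -> d = 1.
Proof.
move=> x0; have [->|d0] := eqVneq d 0; first by rewrite nmulr0 => /eqP; rewrite eq_sym (negbTE x0).
have [sd|sd] := boolP (nonzero_square d).
  by rewrite nmul_square // => xd; apply: (mulfI x0); rewrite mulr1.
move=> xd; have := nonzero_square_nmul x0 d0; rewrite xd (negbTE sd).
by case: nonzero_square.
Qed.

(* A nonsquare [d] has nearfield square [d^(q+1)], so its nearfield power of
   exponent [q - 1] is [d^((q^2-1)/2)]. *)
Lemma iter_nmul_nonsquare (d : F) : d != 0 -> ~~ nonzero_square d ->
  iter q.-1 (nmul q ^~ d) 1 != 1.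
Proof.
move=> d0 sd.
have it2 y k : iter k.*2 (nmul q ^~ d) y = y * d ^+ (q.+1 * k).
  elim: k => [|k IH]; first by rewrite muln0 mulr1.
  rewrite doubleS /= IH !nmul_nonsquare // exprMn frobK mulnS exprD exprS.
  ring.
have -> : q.-1 = (q.-1./2).*2.
  by have := odd_q; have := q_gt2; lia.
rewrite it2 mul1r; have -> : (q.+1 * q.-1./2)%N = N.
  apply: double_inj; rewrite double_N.
  have := odd_q; have := q_gt2; have := odd_double_half q.-1; nia.
by move: sd; rewrite euler_criterion.
Qed.

(* The dilatations with a given centre [y0] act freely off [y0]. *)
Lemma order_dilatation (h : {perm F}) (d y0 : F) (S : {set F}) :
  d != 0 -> (forall y, h y = (y - y0) ** d + y0) ->
  y0 \notin S -> (forall y, y \in S -> h y \in S) -> (#[h]%g %| #|S|)%N.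
Proof.
move=> d0 hE y0S hS; apply: card_free_dvdn => f x /cycleP[i ->].
  by elim: i => [|i IH] Sx; rewrite ?perm1 // expgSr permM; apply/hS/IH.
move=> Sx fx; have [di hi] : exists di, forall y, (h ^+ i)%g y = (y - y0) ** di + y0.
  elim: i {fx} => [|i [di hi]]; first by exists 1 => y; rewrite perm1 nmulr1 subrK.
  by exists (di ** d) => y; rewrite expgSr permM hi hE addrK nmulA.
have di1 : di = 1.
  apply: (@nmul_fix (x - y0)); first by apply: contraNneq y0S => /eqP; rewrite subr_eq0 => /eqP <-.
  by rewrite -[X in X = _](addrK y0) -hi fx.
by apply/permP=> y; rewrite hi di1 nmulr1 subrK perm1.
Qed.

(** * Incidence, collineations and the maps phi and gamma *)

Lemma Aff_on_LAff (x y s t : F) : incident q (Aff x y) (LAff s t) = (x ** s + y + t == 0).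
Proof. by rewrite /incident /= nmulr1 nmul1r. Qed.

Lemma Aff_on_LVert (x y t : F) : incident q (Aff x y) (LVert t) = (x + t == 0).
Proof. by rewrite /incident /= nmulr1 nmul1r nmulr0 addr0. Qed.

Lemma Aff_on_LInf (x y : F) : incident q (Aff x y) LInf = false.
Proof. by rewrite /incident /= nmulr1 !nmulr0 !add0r oner_eq0. Qed.

Lemma Inf_on_LAff (y s t : F) : incident q (Inf y) (LAff s t) = (s + y == 0).
Proof. by rewrite /incident /= nmulr1 nmul1r nmul0r addr0. Qed.

Lemma Inf_on_LVert (y t : F) : incident q (Inf y) (LVert t) = false.
Proof. by rewrite /incident /= nmulr1 nmulr0 nmul0r !addr0 oner_eq0. Qed.

Lemma Inf_on_LInf (y : F) : incident q (Inf y) LInf.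
Proof. by rewrite /incident /= nmulr1 !nmulr0 !addr0. Qed.

Lemma InfV_on_LAff (s t : F) : incident q InfV (LAff s t) = false.
Proof. by rewrite /incident /= nmulr1 !nmul0r addr0 add0r oner_eq0. Qed.

Lemma InfV_on_LVert (t : F) : incident q InfV (LVert t).
Proof. by rewrite /incident /= nmulr1 nmulr0 nmul0r !addr0. Qed.

Lemma InfV_on_LInf : incident q (@InfV F) LInf.
Proof. by rewrite /incident /= nmulr1 !nmulr0 !addr0. Qed.

Definition on_line := (Aff_on_LAff, Aff_on_LVert, Aff_on_LInf, Inf_on_LAff,
  Inf_on_LVert, Inf_on_LInf, InfV_on_LAff, InfV_on_LVert, InfV_on_LInf).

Lemma collineationP (f : {perm point F}) (l : line F) : collineation q f ->
  exists m, forall P, incident q (f P) m = incident q P l.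
Proof.
move=> /forallP/(_ l)/existsP[m /eqP fl]; exists m => P.
have := mem_imset (mem (points_on q l)) P (@perm_inj _ f).
by rewrite /= fl !inE.
Qed.

Lemma collineation1 : collineation q (1%g : {perm point F}).
Proof.
apply/forallP=> l; apply/existsP; exists l; apply/eqP.
by rewrite (eq_imset (g := id)) ?imset_id // => P; rewrite perm1.
Qed.

Lemma imset_perm_mul (T : finType) (f g : {perm T}) (A : {set T}) :
  (f * g)%g @: A = g @: (f @: A).
Proof. by rewrite -imset_comp; apply: eq_imset => P; rewrite permM. Qed.

Lemma collineationM (f g : {perm point F}) :
  collineation q f -> collineation q g -> collineation q (f * g)%g.
Proof.
move=> /forallP Hf /forallP Hg; apply/forallP=> l.
have /existsP[m /eqP fl] := Hf l; have /existsP[n /eqP gm] := Hg m.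
by apply/existsP; exists n; rewrite imset_perm_mul fl gm.
Qed.

(** Points at infinity stay at infinity, since affine points are images of themselves. Each is then
    pinned down by an affine line through it, which two fixed affine points determine. *)
Lemma collineation_fix_affine (f : {perm point F}) : collineation q f ->
  (forall x y, f (Aff x y) = Aff x y) -> f = 1%g.
Proof.
move=> cf ff; have aff P x y : f P = Aff x y -> P = Aff x y.
  by move=> fP; apply: (@perm_inj _ f); rewrite fP ff.
apply/permP=> P; rewrite perm1; case: P => [x y|y|]; first exact: ff.
  have [m mE] := collineationP (LAff (- y) 0) cf.
  have := mE (Aff 0 0); have := mE (Aff 1 y); rewrite !ff.
  case: m mE => [s t|t|] mE; rewrite !on_line ?nmul0r ?nmul1r ?addr0 ?add0r ?addNr !eqxx //.
    move=> sE /eqP tE; move: sE; rewrite tE addr0 => sE.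
    have := mE (Inf y); rewrite !on_line addNr eqxx.
    case fE: (f (Inf y)) => [x' y'|y'|]; rewrite ?on_line //.
      by have := aff _ _ _ fE.
    by move: sE; rewrite !addr_eq0 => /eqP -> /eqP/oppr_inj ->.
  by move=> /eqP t1 /eqP t0; move: t1; rewrite t0 addr0 => /eqP; rewrite oner_eq0.
have [m mE] := collineationP (LVert 0) cf.
have := mE (Aff 0 0); have := mE (Aff 0 1); rewrite !ff.
case: m mE => [s t|t|] mE; rewrite !on_line ?nmul0r ?addr0 ?add0r !eqxx //.
  by move=> /eqP t1 /eqP t0; move: t1; rewrite t0 addr0 => /eqP; rewrite oner_eq0.
have := mE InfV; rewrite !on_line.
case fE: (f InfV) => [x' y'|y'|]; rewrite ?on_line //.
by have := aff _ _ _ fE.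
Qed.

Lemma is_phiP (c d u v : F) (f : {perm point F}) :
  reflect (collineation q f /\ forall x y, f (Aff x y) = Aff (x ** c + u) (y ** d + v))
    (is_phi q c d u v f).
Proof.
apply: (iffP andP) => -[cf H]; split=> //.
  by move=> x y; move/forallP/(_ x)/forallP/(_ y)/eqP: H.
by apply/forallP=> x; apply/forallP=> y; rewrite H.
Qed.

Lemma is_gammaP (c d u v : F) (f : {perm point F}) :
  reflect (collineation q f /\ forall x y, f (Aff x y) = Aff (y ** c + u) (x ** d + v))
    (is_gamma q c d u v f).
Proof.
apply: (iffP andP) => -[cf H]; split=> //.
  by move=> x y; move/forallP/(_ x)/forallP/(_ y)/eqP: H.
by apply/forallP=> x; apply/forallP=> y; rewrite H.
Qed.

Lemma is_phi1 : is_phi q 1 1 0 0 (1%g : {perm point F}).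
Proof.
apply/is_phiP; split; first exact: collineation1.
by move=> x y; rewrite perm1 !nmulr1 !addr0.
Qed.

Lemma is_phiM (c d u v c' d' u' v' : F) (f g : {perm point F}) :
  is_phi q c d u v f -> is_phi q c' d' u' v' g ->
  is_phi q (c ** c') (d ** d') (u ** c' + u') (v ** d' + v') (f * g)%g.
Proof.
move=> /is_phiP[cf fE] /is_phiP[cg gE]; apply/is_phiP.
split; first exact: collineationM.
by move=> x y; rewrite permM fE gE !nmulDl !nmulA !addrA.
Qed.

(** The images of [(0,0)] and [(0,1)] share their second coordinate, so [x = 0] goes to a horizontal
    line. All affine points are images of affine points, so [InfV] goes to the point at infinity of
    that line. *)
Lemma is_gamma_InfV (c d u v : F) (f : {perm point F}) :
  c != 0 -> d != 0 -> is_gamma q c d u v f -> f InfV = Inf 0.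
Proof.
move=> c0 d0 /is_gammaP[cf fE].
have aff x y : f InfV != Aff x y.
  apply/eqP=> fV; have [y' yE] := nmul_surj (x - u) c0.
  have [x' xE] := nmul_surj (y - v) d0.
  suff: InfV = Aff x' y' by [].
  by apply: (@perm_inj _ f); rewrite fV fE xE yE !subrK.
have [m mE] := collineationP (LVert 0) cf.
have := mE (Aff 0 0); have := mE (Aff 0 1); rewrite !fE.
case: m mE => [s t|t|] mE; rewrite !on_line ?nmul0r ?nmul1r ?addr0 ?add0r !eqxx //.
  rewrite nmulDl => /eqP e1 /eqP e0; move: e1; rewrite -!addrA (addrA (u ** s)) e0 addr0.
  move/eqP; rewrite nmul_eq0 (negbTE c0) /= => /eqP s0.
  have := mE InfV; rewrite s0 !on_line.
  case fV: (f InfV) => [x y|y|]; rewrite ?on_line //.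
    by have := aff x y; rewrite fV eqxx.
  by rewrite add0r => /eqP->.
rewrite -addrA => /eqP e1 /eqP e0; move: e1; rewrite e0 addr0 => /eqP.
by rewrite (negbTE c0).
Qed.

(** The part of [grpG] made of maps phi, given a group structure so that orbit counting applies;
    [grpG_phi_aut] identifies the two when [InfV] is in [U] and [Inf 0] is not. *)
Definition phi_aut (U : {set point F}) : {set {perm point F}} :=
  [set f in autU q U | [exists c : F, exists d : F, exists u : F, exists v : F,
     [&& c != 0, d != 0 & is_phi q c d u v f]]].

Lemma phi_autP (U : {set point F}) (f : {perm point F}) :
  reflect (f @: U = U /\ exists c d u v, [/\ c != 0, d != 0 & is_phi q c d u v f])
    (f \in phi_aut U).
Proof.
rewrite !inE; apply: (iffP andP) => [[/andP[_ /eqP fU] /existsP[c /existsP[d]]]|].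
  by case/existsP=> u /existsP[v /and3P[]] c0 d0 fE; split=> //; exists c, d, u, v.
case=> -> [c [d [u [v [c0 d0 fE]]]]]; split.
  by case/andP: fE => -> _ /=.
by apply/existsP; exists c; apply/existsP; exists d; apply/existsP; exists u;
  apply/existsP; exists v; rewrite c0 d0.
Qed.

Lemma group_set_phi_aut (U : {set point F}) : group_set (phi_aut U).
Proof.
apply/group_setP; split=> [|f g].
  apply/phi_autP; split.
    by rewrite (eq_imset (g := id)) ?imset_id // => P; rewrite perm1.
  by exists 1, 1, 0, 0; rewrite oner_eq0 is_phi1.
move=> /phi_autP[fU [c [d [u [v [c0 d0 fE]]]]]] /phi_autP[gU [c' [d' [u' [v' [c'0 d'0 gE]]]]]].
apply/phi_autP; rewrite imset_perm_mul fU gU; split=> //.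
exists (c ** c'), (d ** d'), (u ** c' + u'), (v ** d' + v').
by rewrite !nmul_eq0 !negb_or c0 c'0 d0 d'0 is_phiM.
Qed.

Canonical phi_aut_group U := Group (group_set_phi_aut U).

(** * Counting the points of [U] along vertical and horizontal lines *)

Definition vslice (U : {set point F}) (a : F) : {set F} := [set y | Aff a y \in U].

Definition hslice (U : {set point F}) (b : F) : {set F} := [set x | Aff x b \in U].

Lemma card_affine_part (U : {set point F}) :
  #|U| = (#|U :&: points_on q LInf| + #|[set z : F * F | Aff z.1 z.2 \in U]|)%N.
Proof.
rewrite -(cardsID (points_on q LInf) U); congr (_ + _)%N.
rewrite -(card_imset (f := fun z : F * F => Aff z.1 z.2)); last first.
  by case=> [x y] [x' y'] /= [-> ->].
apply: eq_card => -[x y|y|]; rewrite !inE ?on_line //=.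
- apply/idP/imsetP => [xyU|[[x' y']]]; first by exists (x, y); rewrite ?inE.
  by rewrite inE /= => ? [-> ->].
- by apply/esym/imsetP => -[].
- by apply/esym/imsetP => -[].
Qed.

Lemma card_vslices (U : {set point F}) :
  #|U| = (#|U :&: points_on q LInf| + \sum_a #|vslice U a|)%N.
Proof.
rewrite card_affine_part; congr (_ + _)%N.
under eq_bigr do rewrite -sum1_card.
rewrite pair_big_dep /= -sum1_card; apply: eq_bigl => -[x y].
by rewrite !inE.
Qed.

Lemma card_hslices (U : {set point F}) :
  #|U| = (#|U :&: points_on q LInf| + \sum_b #|hslice U b|)%N.
Proof.
rewrite card_affine_part; congr (_ + _)%N.
under eq_bigr do rewrite -sum1_card.
rewrite (exchange_big_dep predT) //= pair_big_dep /= -sum1_card.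
by apply: eq_bigl => -[x y]; rewrite !inE.
Qed.

(** [LVert (- a)] is the line [x = a]; its point at infinity [InfV] accounts for the successor. *)
Lemma card_on_LVert (U : {set point F}) (a : F) : InfV \in U ->
  #|U :&: points_on q (LVert (- a))| = #|vslice U a|.+1.
Proof.
move=> UV; have -> : U :&: points_on q (LVert (- a)) = InfV |: Aff a @: vslice U a.
  apply/setP=> -[x y|y|]; rewrite !inE ?on_line ?UV //= ?andbF.
  - rewrite subr_eq0; apply/andP/imsetP => [[xyU /eqP xa]|[y']].
      by exists y; rewrite ?inE -xa.
    by rewrite inE => ? [-> ->].
  - by apply/esym/imsetP => -[].
rewrite cardsU1 card_imset; last by move=> y y' [].
by case: imsetP => // -[].
Qed.

Lemma card_on_LAff (U : {set point F}) (b : F) : Inf 0 \notin U ->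
  #|U :&: points_on q (LAff 0 (- b))| = #|hslice U b|.
Proof.
move=> U0; rewrite -(card_imset (f := fun x : F => Aff x b)); last by move=> x x' [].
apply: eq_card => -[x y|y|]; rewrite !inE ?on_line ?andbF //=.
- rewrite nmulr0 add0r subr_eq0; apply/andP/imsetP => [[xyU /eqP yb]|[x']].
    by exists x; rewrite ?inE -yb.
  by rewrite inE => ? [-> ->].
- rewrite add0r; case: eqP => [-> | _]; rewrite ?(negbTE U0) ?andbF;
  by apply/esym/imsetP => -[].
- by apply/esym/imsetP => -[].
Qed.

(** * Unitals through [InfV]: empty vertical slices and homologies *)

Section Unital.

Variable U : {set point F}.
Hypotheses (hU : unital q U) (UInfV : InfV \in U).

Lemma card_vslice (a : F) : #|vslice U a| = 0%N \/ #|vslice U a| = q.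
Proof.
have := hU.2 (LVert (- a)); rewrite card_on_LVert // addn1.
by case=> [[->]|[->]]; [left | right].
Qed.

Lemma card_unital_LInf :
  #|U :&: points_on q LInf| = 1%N \/ #|U :&: points_on q LInf| = (q + 1)%N.
Proof. exact: hU.2. Qed.

(** Each of the [q ^ 2] vertical lines carries [q] affine points of [U] or none; the total is
    compared with [q ^ 3 + 1]. *)
Lemma card_empty_vslices :
  (#|U :&: points_on q LInf| + q ^ 3 = q * #|[set a | vslice U a == set0]| + q ^ 3 + 1)%N.
Proof.
have := card_vslices U; rewrite hU.1.
suff <- : (\sum_a #|vslice U a| + q * #|[set a | vslice U a == set0]| = q ^ 3)%N by lia.
rewrite -sum1_card big_distrr /= [X in (_ + X)%N]big_mkcond -big_split /=.
rewrite (eq_bigr (fun _ : F => q)); first by rewrite sum_nat_const (eq_card (B := F)) // hF -expnSr.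
move=> a _; rewrite inE -cards_eq0; have := q_gt2.
by case: (card_vslice a) => ->; case: eqP => //; lia.
Qed.

(** One point of [U] at infinity leaves no empty slice, [q + 1] points leave exactly one. *)
Lemma card_empty_vslices_le1 : (#|[set a | vslice U a == set0]| <= 1)%N.
Proof.
have := card_empty_vslices; have := q_gt2; have [->|->] := card_unital_LInf; nia.
Qed.

(* [f] fixes every vertical line. If [d <> 1], it acts on each of them as a
   dilatation whose centre has the same second coordinate [y0], and hence an
   order dividing both [q^2 - 1] and [q], as soon as the line is a secant whose
   point at height [y0] is off [U]. *)
Lemma homology_trivial (f : {perm point F}) (d w : F) :
  d != 0 -> f @: U = U -> (forall x y, f (Aff x y) = Aff x (y ** d + w)) -> d = 1.
Proof.
move=> d0 fU fE; apply/eqP/negPn/negP => d1.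
have [y0 y0E] : exists y0, y0 - y0 ** d = w.
  have inj : injective (fun y : F => y - y ** d).
    move=> y y' yy; have yd : (y - y') ** d = y - y'.
      by rewrite nmulBl -[y in RHS](subrK (y ** d)) yy; ring.
    apply/eqP; rewrite -subr_eq0; apply: contraNT d1 => yy0.
    by rewrite (nmul_fix yy0 yd).
  by have [g _ gK] := injF_bij inj; exists (g w); apply: gK.
have fE0 y : y ** d + w = (y - y0) ** d + y0 by rewrite nmulBl -y0E; ring.
have hinj : injective (fun y : F => (y - y0) ** d + y0).
  by move=> y y' /addIr /(nmul_injl d0) /addIr.
pose h : {perm F} := perm hinj.
have hE y : h y = (y - y0) ** d + y0 by rewrite permE.
have [a aU] : exists2 a, vslice U a != set0 & y0 \notin vslice U a.
  case: (pickP (fun a => (vslice U a != set0) && (y0 \notin vslice U a))) => [a|noa].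
    by case/andP; exists a.
  (* Otherwise each [a] gives an empty slice or a point of [U] at height [y0], which is too few
     values for [q ^ 2]. *)
  have : (#|F| <= #|[set a | vslice U a == set0]| + #|hslice U y0|)%N.
    rewrite -cardsT -cardsUI; apply: leq_trans (leq_addr _ _).
    apply: subset_leq_card.
    by apply/subsetP=> a _; have := noa a; rewrite !inE; case: eqP => //= _ /negbFE.
  have : (#|hslice U y0| <= q.+2)%N.
    suff : (#|hslice U y0| <= #|U :&: points_on q (LAff 0 (- y0))%R|)%N.
      by case: (hU.2 (LAff 0 (- y0))) => ->; lia.
    rewrite -(card_imset (f := fun x : F => Aff x y0)); last by move=> x x' [].
    apply/subset_leq_card/subsetP=> _ /imsetP[x + ->].
    by rewrite !inE on_line nmulr0 add0r subrr eqxx andbT.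
  have := card_empty_vslices_le1; have := q_gt2; rewrite hF; nia.
move=> y0U; have hq' : (#[h]%g %| q)%N.
  have <- : #|vslice U a| = q.
    by case: (card_vslice a) => // /eqP; rewrite cards_eq0 (negbTE aU).
  apply: (order_dilatation d0 hE) => // y; rewrite !inE => yU.
  by rewrite hE -fE0 -fE -fU imset_f.
have hq1 : (#[h]%g %| (q ^ 2).-1)%N.
  rewrite -hF -(cardC1 y0) -[X in (_ %| X)%N]cardsE.
  apply: (order_dilatation d0 hE) => //; first by rewrite !inE eqxx.
  move=> y; rewrite !inE => yy0.
  by rewrite hE -subr_eq0 addrK nmul_eq0 negb_or d0 andbT subr_eq0.
have h1 : #[h]%g = 1%N.
  apply/eqP; rewrite -dvdn1.
  have -> : 1%N = (q ^ 2 - (q ^ 2).-1)%N by have := q_gt2; nia.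
  by rewrite dvdn_sub // (dvdn_trans hq') // dvdn_mulr.
move/eqP: h1; rewrite order_eq1 => /eqP h1.
have := hE (1 + y0); rewrite h1 perm1 addrK nmul1r => /addIr dE.
by rewrite -dE eqxx in d1.
Qed.

Lemma phi_aut_mem (f : {perm point F}) (P : point F) :
  f \in phi_aut U -> (f P \in U) = (P \in U).
Proof. by case/phi_autP => fU _; rewrite -{1}fU mem_imset //; apply: perm_inj. Qed.

Lemma is_phi_neq0 (c d u v : F) (f : {perm point F}) :
  is_phi q c d u v f -> c != 0 /\ d != 0.
Proof.
case/is_phiP=> _ fE; split; apply/eqP=> z0.
  suff [] : Aff 0 0 = Aff 1 0 :> point F by apply/eqP; rewrite eq_sym oner_eq0.
  by apply: (@perm_inj _ f); rewrite !fE z0 !nmulr0.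
suff [] : Aff 0 0 = Aff 0 1 :> point F by apply/eqP; rewrite eq_sym oner_eq0.
by apply: (@perm_inj _ f); rewrite !fE z0 !nmulr0.
Qed.

(** The quotient fixes every vertical line, so [homology_trivial] makes it a translation. For
    [w = 0] this shows that delta is well defined; in general it yields elements of [setW]. *)
Lemma phi_aut_quotient (c d d' w : F) (f g : {perm point F}) :
  f \in phi_aut U -> is_phi q c d 0 0 f -> g \in phi_aut U -> is_phi q c d' 0 w g ->
  d' = d /\ is_phi q 1 1 0 w (f^-1 * g)%g.
Proof.
move=> fG fphi gG gphi.
have : (f^-1 * g)%g \in phi_aut U by rewrite (groupM (groupVr fG) gG).
case/phi_autP => hU' [c1 [d1 [u1 [v1 [c10 d10 hphi]]]]].
have [c0 d0] := is_phi_neq0 fphi.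
have /is_phiP[_ fE] := fphi; have /is_phiP[_ gE] := gphi; have /is_phiP[_ hE] := hphi.
(* Evaluating at [f (Aff 0 0)] and [f (Aff 1 1)] gives the coefficients of the quotient without
   computing the inverse of [f]. *)
have hf x y : (f^-1 * g)%g (f (Aff x y)) = g (Aff x y) by rewrite permM permK.
have := hf 0 0; rewrite fE gE hE !addr0 !nmul0r !add0r => -[u1E v1E].
have := hf 1 1; rewrite fE gE hE u1E v1E !addr0 !nmul1r => -[/(nmul_fix c0) c1E].
move/addIr => d1E.
have d11 : d1 = 1.
  apply: (homology_trivial (w := w) d10 hU') => x y.
  by rewrite hE c1E u1E v1E nmulr1 addr0.
by move: hphi d1E; rewrite c1E d11 u1E v1E nmulr1.
Qed.

(** * The line [y = 0] tangent at the origin: gammas and horizontal tangents *)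

Section Tangent.

Hypotheses (UInf0 : Inf 0 \notin U) (Utan : hslice U 0 = [set 0]).

Lemma origin_in : Aff 0 0 \in U.
Proof. by have /[!inE] : 0 \in hslice U 0 by rewrite Utan set11. Qed.

Lemma grpG_phi_aut : grpG q U = phi_aut U.
Proof.
apply/setP=> f; rewrite !inE -!andbA.
case: (boolP (collineation q f)) => //= _; case: eqP => //= fU.
apply/existsP/existsP => -[c /existsP[d /existsP[u /existsP[v]]]].
  case/and3P=> c0 d0 /orP[fE|/(is_gamma_InfV c0 d0) fV]; last first.
    by move: UInfV; rewrite -(mem_imset _ InfV (@perm_inj _ f)) fU fV (negbTE UInf0).
  by exists c; apply/existsP; exists d; apply/existsP; exists u; apply/existsP;
    exists v; rewrite c0 d0.
case/and3P=> c0 d0 fE; exists c; apply/existsP; exists d; apply/existsP; exists u.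
by apply/existsP; exists v; rewrite c0 d0 fE.
Qed.

Lemma grpG1P (c d : F) :
  reflect (exists2 f, f \in phi_aut U & is_phi q c d 0 0 f) (phi_in q (grpG1 q U) c d 0 0).
Proof.
apply: (iffP exists_inP) => -[f fG fphi]; exists f => //.
  by move: fG; rewrite inE grpG_phi_aut => /andP[].
rewrite inE grpG_phi_aut fG inE /=; have [c0 d0] := is_phi_neq0 fphi.
by apply/existsP; exists c; apply/existsP; exists d; rewrite c0 d0.
Qed.

Lemma delta_unique (c : F) : c \in domC q U ->
  exists! d : F, phi_in q (grpG1 q U) c d 0 0.
Proof.
rewrite inE => /existsP[d dP]; exists d; split=> // d' /grpG1P[g gG gphi].
have /grpG1P[f fG fphi] := dP.
by have [] := phi_aut_quotient fG fphi gG gphi.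
Qed.

Lemma card_hslice (b : F) : #|hslice U b| = 1%N \/ #|hslice U b| = (q + 1)%N.
Proof. by have := hU.2 (LAff 0 (- b)); rewrite card_on_LAff. Qed.

(** Each horizontal tangent lowers the total [q ^ 2 * (q + 1)] by [q]. Comparison with [q ^ 3 + 1]
    leaves [q] tangents if [LInf] is tangent and [q + 1] if it is secant. *)
Lemma card_horizontal_tangents : (#|[set b | #|hslice U b| == 1%N]| <= q + 1)%N.
Proof.
have := card_hslices U; rewrite hU.1.
suff : (\sum_b #|hslice U b| + q * #|[set b | #|hslice U b| == 1%N]| = q ^ 2 * (q + 1))%N.
  by have := q_gt2; have [->|->] := card_unital_LInf; nia.
rewrite -sum1_card big_distrr /= [X in (_ + X)%N]big_mkcond -big_split /=.
rewrite (eq_bigr (fun _ : F => (q + 1)%N)); first by rewrite sum_nat_const (eq_card (B := F)) // hF.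
move=> b _; rewrite inE; have := q_gt2.
by case: (card_hslice b) => ->; case: eqP => //; lia.
Qed.

(** * Orbit and stabilizer of the origin *)

Local Notation G := (phi_aut_group U).
Local Notation orb := (orbit 'P G (Aff 0 0)).
Local Notation stab := ('C_G[Aff 0 0 | 'P])%g.

(** Maps phi permute horizontal lines, so the tangent [y = 0] at the origin is carried to a
    horizontal tangent at the image point. *)
Lemma orbit_foot (P : point F) : P \in orb ->
  exists u v, P = Aff u v /\ hslice U v = [set u].
Proof.
case/orbitP=> f fG <-; have /phi_autP[fU [c [d [u [v [c0 d0 /is_phiP[_ fE]]]]]]] := fG.
exists u, v; rewrite /= /aperm fE !nmul0r !add0r; split=> //.
apply/setP=> x; rewrite !inE; 
have [x' xE] := nmul_surj (x - u) c0.
have -> : Aff x v = f (Aff x' 0) by rewrite fE xE nmul0r add0r subrK.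
rewrite phi_aut_mem //; have -> : (Aff x' 0 \in U) = (x' \in hslice U 0) by rewrite inE.
by rewrite Utan inE -[RHS]subr_eq0 -xE nmul_eq0 (negbTE c0) orbF.
Qed.

Lemma card_orb_le : (#|orb| <= q + 1)%N.
Proof.
(* On a tangent [y = v] this is the point of contact; [InfV] is only a default for an empty
   slice. *)
pose foot (v : F) := if [pick u in hslice U v] is Some u then Aff u v else InfV.
apply: leq_trans card_horizontal_tangents; apply: leq_trans (leq_imset_card foot _).
apply/subset_leq_card/subsetP=> P /orbit_foot[u [v [-> uv]]].
apply/imsetP; exists v; first by rewrite inE uv cards1.
by rewrite /foot uv; case: pickP => [u' /set1P->|/(_ u)] //; rewrite set11.
Qed.

Lemma stab_phi (f : {perm point F}) : f \in stab ->
  f \in phi_aut U /\ exists c d, is_phi q c d 0 0 f.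
Proof.
case/setIP=> fG /astab1P /= f0; split=> //; rewrite /aperm in f0.
have /phi_autP[_ [c [d [u [v [_ _ fphi]]]]]] := fG.
exists c, d; move: (fphi); have /is_phiP[_ fE] := fphi.
by move: f0; rewrite fE !nmul0r !add0r => -[-> ->].
Qed.

(** The fixed nonzero [x] gives [c = 1], and then [homology_trivial] gives [d = 1]. *)
Lemma stab_free (f : {perm point F}) (x y : F) :
  f \in stab -> x != 0 -> f (Aff x y) = Aff x y -> f = 1%g.
Proof.
move=> /stab_phi[fG [c [d fphi]]] x0; have /is_phiP[cf fE] := fphi.
rewrite fE !addr0 => -[/(nmul_fix x0) c1 _].
have [_ d0] := is_phi_neq0 fphi; have /phi_autP[fU _] := fG.
have d1 : d = 1.
  by apply: (homology_trivial (w := 0) d0 fU) => x' y'; rewrite fE c1 nmulr1 addr0.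
apply: collineation_fix_affine => // x' y'.
by rewrite fE c1 d1 !nmulr1 !addr0.
Qed.

Lemma stab_inj (x y : F) : x != 0 -> {in stab &, injective (fun f : {perm point F} => f (Aff x y))}.
Proof.
move=> x0 f g fS gS fg; apply/eqP; rewrite eq_mulgV1; apply/eqP.
apply: (stab_free (groupM fS (groupVr gS)) x0 (y := y)).
by rewrite permM fg permK.
Qed.

Definition axis_pts : {set point F} := [set Aff x 0 | x in [set~ 0]].

Lemma card_axis_pts : #|axis_pts| = (q ^ 2).-1.
Proof. by rewrite card_imset ?cardsC1 ?hF // => x x' []. Qed.

Lemma stab_axis_pts (f : {perm point F}) (P : point F) :
  f \in stab -> P \in axis_pts -> f P \in axis_pts.
Proof.
case/stab_phi=> _ [c [d fphi]] /imsetP[x x0 ->].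
have [c0 _] := is_phi_neq0 fphi; have /is_phiP[_ ->] := fphi.
rewrite nmul0r !addr0; apply: imset_f; move: x0.
by rewrite !inE nmul_eq0 negb_or c0 andbT.
Qed.

Lemma card_stab_dvdn : (#|stab| %| (q ^ 2).-1)%N.
Proof.
rewrite -card_axis_pts; apply: card_free_dvdn stab_axis_pts _.
by move=> f P fS /imsetP[x /[!inE] x0 ->]; apply: stab_free.
Qed.

(** * Consequences of the order of the group *)

Hypothesis cardG : #|grpG q U| = (q * (q ^ 2 - 1))%N.

(** Writing [q ^ 2 - 1] as [k * s] with [s] the order of the stabilizer, the orbit has [q * k]
    points, and the bound [q + 1] forces [k = 1]. *)
Lemma card_orb_stab : #|orb| = q /\ #|stab| = (q ^ 2).-1.
Proof.
have := card_orbit_stab 'P G (Aff 0 0); rewrite [#|G|](_ : _ = (q * (q ^ 2 - 1))%N); last first.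
  by rewrite -cardG grpG_phi_aut.
have := card_orb_le; have := q_gt2; have := cardG_gt0 [group of stab] => /=.
have /dvdnP[k kE] := card_stab_dvdn; rewrite subn1 kE.
move: kE; move: #|orb| #|stab| => o s kE s0 q2 oq; rewrite mulnA => /eqP.
rewrite eqn_pmul2r // => /eqP oE; rewrite oE; move: oq; rewrite oE.
have : (0 < k * s)%N by rewrite -kE; nia.
by case: k oE kE => [|[|k]] //; nia.
Qed.

(** A free action of a group of order [q ^ 2 - 1] on as many points is regular. *)
Lemma stab_transitive (c : F) : c != 0 ->
  exists2 f, f \in phi_aut U & exists d, is_phi q c d 0 0 f.
Proof.
move=> c0; have : Aff c 0 \in [set f (Aff 1 0) | f : {perm point F} in stab].
  suff -> : [set f (Aff 1 0) | f : {perm point F} in stab] = axis_pts.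
    by apply: imset_f; rewrite !inE.
  apply/eqP; rewrite eqEcard; apply/andP; split.
    apply/subsetP=> _ /imsetP[f fS ->]; apply: stab_axis_pts => //.
    by apply: imset_f; rewrite !inE oner_eq0.
  by rewrite (card_in_imset (@stab_inj 1 0 (oner_neq0 F))) card_axis_pts card_orb_stab.2.
case/imsetP=> f /stab_phi[fG [c' [d fphi]]]; have /is_phiP[_ fE] := fphi.
by rewrite fE !addr0 nmul1r => -[cE _]; exists f => //; exists d; rewrite cE.
Qed.

(** By freeness, an orbit point off [x = 0] would have [q ^ 2 - 1] images under the stabilizer, all
    within an orbit of size [q]. *)
Lemma orb_vertical (u v : F) : Aff u v \in orb -> u = 0.
Proof.
move=> uvO; apply/eqP/negPn/negP => u0.
have : (#|stab| <= #|orb|)%N.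
  rewrite -(card_in_imset (@stab_inj u v u0)); apply/subset_leq_card/subsetP.
  move=> _ /imsetP[f /setIP[fG _] ->].
  by apply: (orbit_trans (y := Aff u v)) uvO; apply: (mem_orbit 'P (Aff u v) fG).
rewrite card_orb_stab.1 card_orb_stab.2; have := q_gt2; nia.
Qed.

Lemma vslice0_orb (y : F) : (y \in vslice U 0) = (Aff 0 y \in orb).
Proof.
have sub : orb \subset [set Aff 0 y | y in vslice U 0].
  apply/subsetP=> P PO; have [u [v [PE uv]]] := orbit_foot PO.
  move: PO; rewrite PE => /orb_vertical u0; rewrite u0 in uv *.
  apply: imset_f; have : 0 \in hslice U v by rewrite uv set11.
  by rewrite !inE.
have : #|[set Aff 0 y | y in vslice U 0]| = q.
  rewrite card_imset; last by move=> x x' [].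
  case: (card_vslice 0) => // /eqP; rewrite cards_eq0 => /eqP/setP/(_ 0).
  by rewrite !inE origin_in.
rewrite -[RHS]card_orb_stab.1 => card_eq.
have /eqP -> : orb == [set Aff 0 y | y in vslice U 0] by rewrite eqEcard sub card_eq /=.
by rewrite mem_imset // => x x' [].
Qed.

Lemma setW_vslice0 : setW q U = vslice U 0.
Proof.
apply/setP=> w; rewrite inE; apply/exists_inP/idP => [[f]|].
  rewrite grpG_phi_aut => fG /is_phiP[_ fE].
  have := phi_aut_mem (Aff 0 0) fG; rewrite fE !nmul0r !add0r origin_in.
  by rewrite inE => ->.
rewrite vslice0_orb => wO; have /orbitP[g gG] := wO; rewrite /= /aperm.
have /phi_autP[_ [c [d [u [v [c0 _ gphi]]]]]] := gG; have /is_phiP[_ gE] := gphi.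
rewrite gE !nmul0r !add0r => -[u0 vw]; rewrite u0 vw in gphi.
(* Dividing [g] by an element of the stabilizer with the same [c] leaves the translation by [w]. *)
have [f fG [d' fphi]] := stab_transitive c0.
have [_ hphi] := phi_aut_quotient fG fphi gG gphi.
by exists (f^-1 * g)%g => //; rewrite grpG_phi_aut (groupM (groupVr fG) gG).
Qed.

Lemma setW0 : 0 \in setW q U.
Proof. by rewrite setW_vslice0 inE origin_in. Qed.

Lemma card_setW : #|setW q U| = q.
Proof.
case: (card_vslice 0) => [/eqP|]; rewrite -setW_vslice0 //.
by rewrite cards_eq0 => /eqP/setP/(_ 0); rewrite setW0 inE.
Qed.

Lemma translate_in (x y w : F) : w \in setW q U -> Aff x y \in U -> Aff x (y + w) \in U.
Proof.
rewrite inE => /exists_inP[f]; rewrite grpG_phi_aut => fG /is_phiP[_ fE].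
by rewrite -(phi_aut_mem (Aff x y) fG) fE !nmulr1 addr0.
Qed.

Lemma delta_square (c d : F) (f : {perm point F}) :
  f \in phi_aut U -> is_phi q c d 0 0 f -> nonzero_square d.
Proof.
move=> fG fphi; have [_ d0] := is_phi_neq0 fphi; have /is_phiP[_ fE] := fphi.
apply/negPn/negP => sd; have := iter_nmul_nonsquare d0 sd; apply/negP/negPn.
pose h : {perm F} := perm (nmul_injl d0).
have hE y : h y = y ** d by rewrite permE.
have cardW0 : #|vslice U 0 :\ 0| = q.-1.
  by rewrite -setW_vslice0; have := cardsD1 0 (setW q U); rewrite card_setW setW0 => /(congr1 predn).
have : (#[h]%g %| q.-1)%N.
  rewrite -cardW0; apply: (order_dilatation (y0 := 0) d0) => //.
  - by move=> y; rewrite hE subr0 addr0.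
  - by rewrite !inE eqxx.
  move=> y; rewrite !inE hE nmul_eq0 negb_or d0 andbT => /andP[-> yU] /=.
  by rewrite -(phi_aut_mem _ fG) fE nmul0r !addr0 in yU.
(* At 1 the power of [h] is the nearfield power of [d] with exponent [q - 1]. *)
rewrite order_dvdn => /eqP/permP/(_ 1); rewrite perm1 permX => hq1.
by rewrite -(eq_iter hE) hq1.
Qed.

(** The stabilizer permutes the lines [x = a], [a != 0], transitively, so one empty slice among them
    would make all [q ^ 2 - 1] empty, while at most one can be. *)
Lemma vslice_neq0 (a : F) : vslice U a != set0.
Proof.
have [->|a0] := eqVneq a 0.
  by apply/set0Pn; exists 0; rewrite inE origin_in.
have vslice1 x : x != 0 -> (vslice U x == set0) = (vslice U 1 == set0).
  move=> x0; have [f fG [d fphi]] := stab_transitive x0.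
  have [_ d0] := is_phi_neq0 fphi; have /is_phiP[_ fE] := fphi.
  apply/eqP/eqP => /setP sl0; apply/setP=> y; rewrite !inE.
    by have := sl0 (y ** d); rewrite !inE -(phi_aut_mem (Aff 1 y) fG) fE nmul1r !addr0.
  have [y' yE] := nmul_surj y d0.
  by have := sl0 y'; rewrite !inE -(phi_aut_mem (Aff 1 y') fG) fE nmul1r !addr0 yE.
rewrite vslice1 //; apply/negP => sl1.
have := card_empty_vslices_le1; apply/negP; rewrite -ltnNge.
have : (#|[set~ (0 : F)%R]| <= #|[set a | vslice U a == set0]|)%N.
  by apply/subset_leq_card/subsetP=> x; rewrite !inE => /vslice1->.
rewrite cardsC1 hF; have := q_gt2; nia.
Qed.

Lemma unital_LInf : U :&: points_on q LInf = [set InfV].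
Proof.
have := card_empty_vslices; have -> : [set a | vslice U a == set0] = set0.
  by apply/setP=> a; rewrite !inE (negbTE (vslice_neq0 a)).
rewrite cards0 muln0 add0n addnC => /addnI /eqP/cards1P[P UP].
have : InfV \in U :&: points_on q LInf by rewrite !inE UInfV on_line.
by rewrite UP => /set1P ->.
Qed.

Lemma unital_normal_form (delta : F -> F) : is_delta q U delta ->
  exists b : F, [/\ b != 0, b \notin setW q U &
    U = [set Aff x (b * delta x + w) | x : F, w : F in setW q U] :|: [set InfV]].
Proof.
case=> delta0 deltaP; have /set0Pn[b] := vslice_neq0 1; rewrite inE => bU.
(* If [b] were in [setW], then [y = b] would be tangent at [(0,b)], yet it also contains [(1,b)]. *)
have bW : b \notin setW q U.
  rewrite setW_vslice0 vslice0_orb; apply/negP=> /orbit_foot[u [v [[<- <-] /setP/(_ 1)]]].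
  by rewrite !inE bU oner_eq0.
have b0 : b != 0 by apply: contraNneq bW => ->; apply: setW0.
exists b; split=> //.
have in_U x w : w \in setW q U -> Aff x (b * delta x + w) \in U.
  move=> wW; apply: translate_in => //.
  have [->|x0] := eqVneq x 0; first by rewrite delta0 mulr0 origin_in.
  have [f fG [d fphi]] := stab_transitive x0.
  have dP : phi_in q (grpG1 q U) x d 0 0 by apply/grpG1P; exists f.
  rewrite (deltaP x d) //; last by rewrite inE; apply/existsP; exists d.
  (* Since [d] is a square, the field product [b * d] is the nearfield product occurring in the
     image of [(1,b)] under [f]. *)
  rewrite -nmul_square ?(delta_square fG fphi) //; have /is_phiP[_ fE] := fphi.
  by rewrite -(phi_aut_mem _ fG) fE nmul1r !addr0 in bU.
(* The coset of [setW] lies in the slice and has [q] elements, the most a slice can have. *)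
have sliceE x : vslice U x = [set b * delta x + w | w in setW q U].
  apply/esym/eqP; rewrite eqEcard; apply/andP; split.
    by apply/subsetP=> _ /imsetP[w wW ->]; rewrite inE in_U.
  rewrite card_imset ?card_setW; last exact: addrI.
  by case: (card_vslice x) => ->.
apply/setP=> -[x y|y|]; rewrite !inE ?UInfV ?orbT // orbF.
  apply/idP/imset2P => [xyU|[x' w _ wW ->]]; last exact: in_U.
  have : y \in vslice U x by rewrite inE.
  by rewrite sliceE => /imsetP[w wW ->]; exists x w.
have -> : (Inf y \in U) = (Inf y \in U :&: points_on q LInf) by rewrite !inE on_line andbT.
by rewrite unital_LInf inE; apply/esym/imset2P => -[].
Qed.

End Tangent.

End Unital.

End Nearfield.

Theorem theorem9p3 (p e q : nat) (F : finFieldType)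
    (hp : prime p) (podd : odd p) (he : (0 < e)%N)
    (hq : q = (p ^ e)%N) (hF : #|F| = (q ^ 2)%N)
    (U : {set point F}) (hU : unital q U)
    (U010 : InfV \in U) (U001 : Aff 0 0 \in U)
    (htan : exists l : line F,
       tangent_at q U (Aff 0 0) l /\ incident q (Inf 0) l) :
  (forall c : F, c \in domC q U ->
     exists! d : F, phi_in q (grpG1 q U) c d 0 0) /\
  (#|grpG q U| = (q * (q ^ 2 - 1))%N ->
   forall delta : F -> F, is_delta q U delta ->
   exists b : F,
     [/\ b != 0, b \notin setW q U &
         U = [set Aff x (b * delta x + w) | x : F, w : F in setW q U]
             :|: [set InfV]]).
Proof.
have [UInf0 Utan] : Inf 0 \notin U /\ hslice U 0 = [set 0].
  case: htan => l [[_ [l0 /eqP/cards1P[P lP]]] linf].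
  have P0 : Aff 0 0 = P by apply/set1P; rewrite -lP !inE U001.
  have Uinf0 : Inf 0 \notin U.
    apply/negP=> Uinf0; suff : Inf 0 \in [set P] by rewrite -P0 inE.
    by rewrite -lP !inE Uinf0.
  split=> //; apply/setP=> x; rewrite !inE.
  (* The line joining the origin to [Inf 0] is [y = 0]. *)
  have {l0 linf} lE : l = LAff 0 0.
    case: l l0 linf {lP} => [s t|t|]; rewrite !(on_line hp podd he hq hF) //.
    by rewrite (nmul0r hp podd he hq) !add0r addr0 => /eqP-> /eqP->.
  have : (Aff x 0 \in U :&: points_on q l) = (Aff x 0 == P) by rewrite lP inE.
  rewrite lE !inE (on_line hp podd he hq hF) nmulr0 !addr0 eqxx andbT -P0 => ->.
  by apply/eqP/eqP => [[]|->].
split; first exact: (delta_unique hp podd he hq hF hU U010 UInf0).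
exact: (unital_normal_form hp podd he hq hF hU U010 UInf0 Utan).
Qed.
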